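(* Let $\mathscr{Y}$ be a non-empty set and $\overline{\mathscr{L}}_b(\mathscr{Y})\subseteq\mathscr{D}\subseteq\overline{\mathscr{L}}(\mathscr{Y})$. For any upper expectation $\overline{\mathrm{E}}$ on $\mathscr{D}$, define $\overline{\mathrm{E}}_{\downarrow}\colon\overline{\mathscr{L}}(\mathscr{Y})\to\overline{\mathbb{R}}$ by $\overline{\mathrm{E}}_{\downarrow}(f)=\lim_{c\to-\infty}\overline{\mathrm{E}}(f^{\vee c})$, where $f^{\vee c}(y)=\max\{f(y),c\}$. Then $\overline{\mathrm{E}}_{\downarrow}$ is an upper expectation on $\overline{\mathscr{L}}(\mathscr{Y})$ that coincides with $\overline{\mathrm{E}}$ on $\overline{\mathscr{L}}_b(\mathscr{Y})$ (and hence extends $\overline{\mathrm{E}}$ if $\mathscr{D}=\overline{\mathscr{L}}_b(\mathscr{Y})$), and that moreover satisfies: (E6) $\overline{\mathrm{E}}_{\downarrow}(f)=\lim_{c\to-\infty}\overline{\mathrm{E}}_{\downarrow}(f^{\vee c})$ for all $f\in\overline{\mathscr{L}}(\mathscr{Y})$; (E2') $\overline{\mathrm{E}}_{\downarrow}(f+g)\le\overline{\mathrm{E}}_{\downarrow}(f)+\overline{\mathrm{E}}_{\downarrow}(g)$ for all $f,g\in\overline{\mathscr{L}}(\mathscr{Y})$; (E3') $\overline{\mathrm{E}}_{\downarrow}(\lambda f)=\lambda\overline{\mathrm{E}}_{\downarrow}(f)$ for all real $\lambda>0$ and all $f\in\overline{\mathscr{L}}(\mathscr{Y})$; (E4') $f\le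 g\Rightarrow\overline{\mathrm{E}}_{\downarrow}(f)\le\overline{\mathrm{E}}_{\downarrow}(g)$ for all $f,g\in\overline{\mathscr{L}}(\mathscr{Y})$.
   Context: Notation: $\overline{\mathbb{R}}=\mathbb{R}\cup\{-\infty,+\infty\}$, with the conventions $+\infty-\infty=-\infty+\infty=+\infty$ and $0\cdot(\pm\infty)=0$; $\mathbb{N}_0=\{0,1,2,\dots\}$. $\overline{\mathscr{L}}(\mathscr{Y})$ is the set of all maps $\mathscr{Y}\to\overline{\mathbb{R}}$ and $\overline{\mathscr{L}}_b(\mathscr{Y})$ the subset of those bounded below by a real constant. Limits and inequalities of functions are pointwise. For $\overline{\mathscr{L}}_b(\mathscr{Y})\subseteq\mathscr{D}\subseteq\overline{\mathscr{L}}(\mathscr{Y})$, an upper expectation on $\mathscr{D}$ is a map $\overline{\mathrm{E}}\colon\mathscr{D}\to\overline{\mathbb{R}}$ such that: (E1) $\overline{\mathrm{E}}(c)=c$ for all $c\in\mathbb{R}$; (E2) $\overline{\mathrm{E}}(f+g)\le\overline{\mathrm{E}}(f)+\overline{\mathrm{E}}(g)$ for all $f,g\in\overline{\mathscr{L}}_b(\mathscr{Y})$; (E3) $\overline{\mathrm{E}}(\lambda f)=\lambda\overline{\mathrm{E}}(f)$ for all real $\lambda>0$ and $f\in\overline{\mathscr{L}}_b(\mathscr{Y})$; (E4) $f\le g\Rightarrow\overline{\mathrm{E}}(f)\le\overline{\mathrm{E}}(g)$ for all $f,g\in\overline{\mathscr{L}}_b(\mathscr{Y})$; (E5) $\lim_n\overline{\mathrm{E}}(f_n)=\overline{\mathrm{E}}(\lim_n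 f_n)$ for every non-decreasing sequence $\{f_n\}_{n\in\mathbb{N}_0}$ of non-negative variables in $\overline{\mathscr{L}}_b(\mathscr{Y})$. (By (E4), the limit defining $\overline{\mathrm{E}}_{\downarrow}$ exists, since $f^{\vee c}\in\overline{\mathscr{L}}_b(\mathscr{Y})$ is non-decreasing in $c$.) *)

(* Defs.v *)
From HB Require Import structures.
From mathcomp Require Import all_boot all_order all_algebra.
From mathcomp Require Import all_classical all_reals all_analysis.

Set Implicit Arguments.
Unset Strict Implicit.
Unset Printing Implicit Defensive.

Import Order.TTheory GRing.Theory Num.Theory.
Import numFieldNormedType.Exports.

Local Open Scope classical_set_scope.
Local Open Scope ring_scope.
Local Open Scope ereal_scope.

Section UpperExpectation.
Context {R : realType} {Y : Type}.

Definition lower_bounded : set (Y -> \bar R) :=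
  [set f | exists c : R, forall y, c%:E <= f y].

(* Sums of extended reals are taken with the dual addition (%dE), for which
   +oo + -oo = -oo + +oo = +oo; the default addition of \bar R gives -oo. *)
Definition fsum (f g : Y -> \bar R) : Y -> \bar R := fun y => (f y + g y)%dE.

Definition fscale (a : R) (f : Y -> \bar R) : Y -> \bar R :=
  fun y => a%:E * f y.

Definition cutoff (f : Y -> \bar R) (c : R) : Y -> \bar R :=
  fun y => maxe (f y) c%:E.

Definition flim (f : nat -> Y -> \bar R) : Y -> \bar R :=
  fun y => limn (fun n => f n y).

Lemma lower_bounded_cst (c : R) : lower_bounded (fun=> c%:E).
Proof. by exists c. Qed.

Lemma lower_bounded_sum f g :
  lower_bounded f -> lower_bounded g -> lower_bounded (fsum f g).
Proof.
move=> [c cf] [d dg]; exists (c + d)%R => y; rewrite /fsum.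
move: (cf y) (dg y); case: (f y) => [r||]; case: (g y) => [s||] //.
- by rewrite !lee_fin => cr ds; exact: (lerD cr ds).
- by move=> _ _; exact: leey.
- by move=> _ _; exact: leey.
- by move=> _ _; exact: leey.
Qed.

Lemma lower_bounded_scale (a : R) f :
  (0 < a)%R -> lower_bounded f -> lower_bounded (fscale a f).
Proof.
by move=> a0 [c cf]; exists (a * c)%R => y; rewrite EFinM lee_pmul2l.
Qed.

Lemma lower_bounded_cutoff f (c : R) : lower_bounded (cutoff f c).
Proof. by exists c => y; rewrite /cutoff le_max lexx orbT. Qed.

Lemma lower_bounded_lim (f : nat -> Y -> \bar R) :
  (forall n y, 0 <= f n y) ->
  (forall y, nondecreasing_seq (fun n => f n y)) ->
  lower_bounded (flim f).
Proof.
move=> f0 nf; exists 0%R => y; apply: lime_ge; last by near do exact: f0.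
exact: ereal_nondecreasing_is_cvgn.
Unshelve. all: by end_near. Qed.

(* A functional on D is a map out of the subtype [set_type D], to which D
   coerces; [inD bD bf] is f seen as an element of that subtype. *)
Definition inD (D : set (Y -> \bar R)) (bD : lower_bounded `<=` D) f
  (bf : lower_bounded f) : D := SigSub (mem_set (bD f bf)).

Record upper_expectation (D : set (Y -> \bar R)) (bD : lower_bounded `<=` D)
    (E : D -> \bar R) : Prop := UpperExpectation {
  ue_cst : forall c : R, E (inD bD (lower_bounded_cst c)) = c%:E ;
  ue_sub : forall f g (bf : lower_bounded f) (bg : lower_bounded g),
    E (inD bD (lower_bounded_sum bf bg))
      <= (E (inD bD bf) + E (inD bD bg))%dE ;
  ue_scale : forall (a : R) (a0 : (0 < a)%R) f (bf : lower_bounded f),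
    E (inD bD (lower_bounded_scale a0 bf)) = a%:E * E (inD bD bf) ;
  ue_le : forall f g (bf : lower_bounded f) (bg : lower_bounded g),
    (forall y, f y <= g y) -> E (inD bD bf) <= E (inD bD bg) ;
  ue_lim : forall (f : nat -> Y -> \bar R) (bf : forall n, lower_bounded (f n))
      (f0 : forall n y, 0 <= f n y)
      (nf : forall y, nondecreasing_seq (fun n => f n y)),
    E (inD bD (bf n)) @[n --> \oo] --> E (inD bD (lower_bounded_lim f0 nf))
}.

Definition Edown (D : set (Y -> \bar R)) (bD : lower_bounded `<=` D)
    (E : D -> \bar R) (f : Y -> \bar R) : \bar R :=
  lim (E (inD bD (lower_bounded_cutoff f c)) @[c --> -oo%R]).

End UpperExpectation.

Arguments lower_bounded : clear implicits.

(* Main.v *)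
(* By (E4), the map c |-> E (max(f, c)) is nondecreasing, so its limit at -oo
   is its infimum. On bounded-below f that infimum is attained at any lower
   bound, which gives the coincidence with E and the cutoff property (E6);
   (E2')-(E4') then pass from the cutoffs to their infima. *)

Require Import Defs.
From HB Require Import structures.
From mathcomp Require Import all_boot all_order all_algebra.
From mathcomp Require Import all_classical all_reals all_analysis.
Import Order.TTheory GRing.Theory Num.Theory.
Import numFieldNormedType.Exports.
Local Open Scope classical_set_scope.
Local Open Scope ring_scope.
Local Open Scope ereal_scope.

Import DualAddTheory.

(** The reflection [r |-> -r] turns this into the convergence of a nonincreasing function at [+oo],
    and it leaves the range unchanged. *)
Lemma nondecreasing_ninfty_cvge (R : realType) (f : R -> \bar R) :
  nondecreasing_fun f -> f r @[r --> -oo%R] --> ereal_inf (range f).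
Proof.
move=> ndf; apply/cvgNy_compNP.
have -> : range f = range (f \o -%R).
  apply/seteqP; split => _ [r _ <-].
    by exists (- r)%R; rewrite //= opprK.
  by exists (- r)%R.
by apply: nonincreasing_cvge => r s rs; apply: ndf; rewrite lerN2.
Qed.

(** Reduces subadditivity to real upper bounds. If [x] or [y] is [+oo], no such bound exists for it,
    but the dual sum is then [+oo] and the claim is trivial; with the default addition, [-oo + +oo]
    would break it. *)
Lemma lee_dadd_lt (R : realType) (x y z : \bar R) :
  (forall a b : R, x < a%:E -> y < b%:E -> z <= (a + b)%:E) ->
  z <= (x + y)%dE.
Proof.
have leNy : (forall e : R, z <= e%:E) -> z <= -oo.
  case: z => [t|/(_ 0%R)|//] //.
  by move=> /(_ (t - 1)%R); rewrite lee_fin leNgt ltrBlDr ltrDl ltr01.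
case: x => [r||]; case: y => [s||] H; rewrite ?daddey ?daddye ?leey//.
- apply/lee_addgt0Pr => e e0.
  have := H (r + e / 2)%R (s + e / 2)%R.
  rewrite !lte_fin !ltrDl divr_gt0// => /(_ isT isT).
  by rewrite addrACA -splitr EFinD.
(* Any real lies above [-oo], so the second bound is free to be chosen so that the two sum to the
   arbitrary [e]. *)
- apply: leNy => e; have := H (r + 1)%R (e - (r + 1))%R.
  by rewrite lte_fin ltrDl ltr01 ltNyr addrC subrK => /(_ isT isT).
- apply: leNy => e; have := H (e - (s + 1))%R (s + 1)%R.
  by rewrite lte_fin ltrDl ltr01 ltNyr subrK => /(_ isT isT).
- apply: leNy => e; have := H e 0%R.
  by rewrite !ltNyr addr0 => /(_ isT isT).
Qed.

Section Edown.
Context {R : realType} {Y : Type} {D : set (Y -> \bar R)}.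
Context {bD : lower_bounded R Y `<=` D} {E : D -> \bar R}.
Context (ueE : upper_expectation bD E).
Implicit Types f g : Y -> \bar R.

(** The arguments of [E] carry proofs of boundedness, which blocks rewriting [f] into [g];
    injectivity of [val] makes these proofs irrelevant. *)
Lemma E_inD_congr {f g} (bf : lower_bounded R Y f) (bg : lower_bounded R Y g) :
  f = g -> E (inD bD bf) = E (inD bD bg).
Proof. by move=> fg; congr E; exact: val_inj. Qed.

Let Ecut f (c : R) := E (inD bD (lower_bounded_cutoff f c)).

Lemma Ecut_ndecr f : nondecreasing_fun (Ecut f).
Proof.
move=> c d cd; apply: (ue_le ueE) => y.
by rewrite /cutoff ge_max !le_max lexx lee_fin cd orbT.
Qed.

Lemma Ecut_cvg f : Ecut f c @[c --> -oo%R] --> ereal_inf (range (Ecut f)).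
Proof. by apply: nondecreasing_ninfty_cvge; exact: Ecut_ndecr. Qed.

Lemma EdownE f : Edown bD E f = ereal_inf (range (Ecut f)).
Proof. by apply/cvg_lim => //; exact: Ecut_cvg. Qed.

Lemma Edown_le_Ecut f c : Edown bD E f <= Ecut f c.
Proof. by rewrite EdownE; apply: ereal_inf_lbound; exists c. Qed.

Lemma Edown_le f g : (forall y, f y <= g y) -> Edown bD E f <= Edown bD E g.
Proof.
move=> fg; rewrite (EdownE g); apply: le_ereal_inf_tmp => _ [c _ <-].
apply: le_trans (Edown_le_Ecut f c) _; apply: (ue_le ueE) => y.
by rewrite /cutoff ge_max !le_max fg lexx orbT.
Qed.

Lemma Edown_lower_bounded {f} (bf : lower_bounded R Y f) :
  Edown bD E f = E (inD bD bf).
Proof.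
apply/eqP; rewrite eq_le; apply/andP; split.
  have [c cf] := bf; apply: le_trans (Edown_le_Ecut f c) _.
  by apply: (ue_le ueE) => y; rewrite /cutoff ge_max lexx cf.
rewrite EdownE; apply: le_ereal_inf_tmp => _ [c _ <-].
by apply: (ue_le ueE) => y; rewrite /cutoff le_max lexx.
Qed.

(** Each cutoff is bounded below, so [Edown] agrees with [E] on it and the limit is the one that
    defines [Edown]. *)
Lemma Edown_cutoff_cvg f :
  Edown bD E (cutoff f c) @[c --> -oo%R] --> Edown bD E f.
Proof.
rewrite EdownE; under eq_cvg do
  rewrite (Edown_lower_bounded (lower_bounded_cutoff f _)).
exact: Ecut_cvg.
Qed.

(* The cutoffs satisfy max(f + g, 2c) <= max(f, c) + max(g, c). *)
Lemma Edown_sub f g :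
  Edown bD E (fsum f g) <= (Edown bD E f + Edown bD E g)%dE.
Proof.
apply: lee_dadd_lt => a b; rewrite !EdownE.
move=> /ereal_inf_lt[_ [c _ <-] fa] /ereal_inf_lt[_ [d _ <-] gb].
(* The bounds for [f] and [g] hold at different levels; by monotonicity both persist at the smaller
   level. *)
pose m := Num.min c d.
have fma : Ecut f m <= a%:E.
  by apply: le_trans (ltW fa); apply: Ecut_ndecr; rewrite ge_min lexx.
have gmb : Ecut g m <= b%:E.
  by apply: le_trans (ltW gb); apply: Ecut_ndecr; rewrite ge_min lexx orbT.
rewrite -EdownE; apply: le_trans (Edown_le_Ecut _ (m + m)%R) _.
have := lee_dD fma gmb; apply: le_trans.
apply: le_trans (ue_sub ueE _ _); apply: (ue_le ueE) => y.
rewrite /cutoff /fsum ge_max; apply/andP; split.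
  by apply: lee_dD; rewrite le_max lexx.
have -> : (m + m)%:E = (m%:E + m%:E)%dE by [].
by apply: lee_dD; rewrite le_max lexx orbT.
Qed.

(** Since [a * max(f, c) = max(a * f, a * c)], scaling only relabels the levels by the bijection
    [c |-> a * c], and a positive factor commutes with the infimum. *)
Lemma Edown_scale (a : R) f : (0 < a)%R ->
  Edown bD E (fscale a f) = a%:E * Edown bD E f.
Proof.
move=> a0; rewrite !EdownE -ereal_inf_pZl//; congr ereal_inf.
have EcutZ c : Ecut (fscale a f) (a * c) = a%:E * Ecut f c.
  rewrite /Ecut -(ue_scale ueE a0); apply: E_inD_congr.
  by apply/funext => y; rewrite /cutoff /fscale maxe_pMr// ?lee_fin ?ltW.
apply/seteqP; split => [_ [c _ <-]|_ [_ [c _ <-] <-]].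
  exists (Ecut f (a^-1 * c)); first by exists (a^-1 * c)%R.
  by rewrite -EcutZ mulrA divff ?gt_eqF// mul1r.
by exists (a * c)%R.
Qed.

Lemma Edown_upper_expectation :
  upper_expectation (@subsetT _ (lower_bounded R Y))
    (fun f : [set: Y -> \bar R] => Edown bD E (val f)).
Proof.
split => /=.
- by move=> c; rewrite (Edown_lower_bounded (lower_bounded_cst c)) (ue_cst ueE).
- by move=> f g _ _; exact: Edown_sub.
- by move=> a a0 f _; exact: Edown_scale.
- by move=> f g _ _; exact: Edown_le.
(* The sequence and its limit are all bounded below, so (E5) is inherited directly from [E]. *)
- move=> f bf f0 nf; rewrite (Edown_lower_bounded (lower_bounded_lim f0 nf)).
  under eq_cvg do rewrite (Edown_lower_bounded (bf _)).
  exact: (ue_lim ueE).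
Qed.

End Edown.

Theorem proposition2 (R : realType) (Y : Type) (Y0 : [set: Y] !=set0)
    (D : set (Y -> \bar R)) (bD : lower_bounded R Y `<=` D)
    (E : D -> \bar R) (ueE : upper_expectation bD E) :
  [/\ upper_expectation (@subsetT _ (lower_bounded R Y))
        (fun f : [set: Y -> \bar R] => Edown bD E (val f)),
      (forall f (bf : lower_bounded R Y f), Edown bD E f = E (inD bD bf))
      /\ (D = lower_bounded R Y -> forall f : D, Edown bD E (val f) = E f)
    & [/\ forall f : Y -> \bar R,
            Edown bD E (cutoff f c) @[c --> -oo%R] --> Edown bD E f,
          forall f g : Y -> \bar R,
            Edown bD E (fsum f g) <= (Edown bD E f + Edown bD E g)%dE,
          forall (a : R) (f : Y -> \bar R), (0 < a)%R ->
            Edown bD E (fscale a f) = a%:E * Edown bD E f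
        & forall f g : Y -> \bar R, (forall y, f y <= g y) ->
            Edown bD E f <= Edown bD E g]].
Proof.
split; first exact: Edown_upper_expectation.
- split=> [f bf|DE f]; first exact: Edown_lower_bounded.
  have bf : lower_bounded R Y (val f) by rewrite -DE; exact/set_mem/valP.
  by rewrite (Edown_lower_bounded ueE bf); congr E; exact: val_inj.
- split.
  + exact: Edown_cutoff_cvg.
  + exact: Edown_sub.
  + by move=> a f; exact: Edown_scale.
  + by move=> f g; exact: Edown_le.
Qed.
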